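(* Let $Y$ be a Seifert fibered homology $3$-sphere with Seifert invariants $(-c_0;(m_1,c_1),\dots,(m_n,c_n))$, where $n\ge3$ and, if $n=3$, $\{m_1,m_2,m_3\}\neq\{2,3,5\}$. Let $X$ be a Dolgachev surface with invariants $(m_1,\dots,m_n)$. Then there exists a bijection $$\varphi:\mathrm{Hom}^*(\pi_1(Y),\mathrm{PU}(2,1))\to\mathrm{Hom}^*(\pi_1(X),\mathrm{PU}(2,1)).$$
   Context: The integers $m_1,\dots,m_n\ge 2$ are pairwise coprime, and $\pi_1(Y)=\langle t_1,\dots,t_n,h\mid t_k^{m_k}h^{c_k}=t_1\cdots t_nh^{c_0}=[h,t_k]=1\rangle$, whose center is generated by $h$. Dolgachev surface: blowing up $\mathbb{CP}^2$ at the nine base points of a generic pencil of cubics gives an elliptic fibration $X_0\to\mathbb{CP}^1$; applying logarithmic transformations along $n$ disjoint nonsingular fibres with multiplicities $m_1,\dots,m_n$ gives the elliptic surface $X\to\mathbb{CP}^1$. It is known that $\pi_1(X)\cong\pi_1(Y)/Z(\pi_1(Y))=\langle t_1,\dots,t_n\mid t_k^{m_k}=t_1\cdots t_n=1\rangle$. $\mathrm{PU}(2,1)$ is the quotient by its center of the group $\mathrm{U}(2,1)$ of linear automorphisms of $\mathbb{C}^3$ preserving $|z_0|^2-|z_1|^2-|z_2|^2$. For a group $H$, a representation $\rho:H\to\mathrm{PU}(2,1)$ is irreducible if the induced action of $H$ on the Lie algebra of $\mathrm{PU}(2,1)$ via the adjoint representation is irreducible; $\mathrm{Hom}^*(H,\mathrm{PU}(2,1))$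 is the set of irreducible representations. *)

(* Defs.v *)
From HB Require Import structures.
From mathcomp Require Import all_boot all_order all_algebra.
From mathcomp Require Import boolp classical_sets functions reals.
From mathcomp Require Import complex.
From mathcomp Require Import ring.

Set Implicit Arguments.
Unset Strict Implicit.
Unset Printing Implicit Defensive.

Import Order.TTheory GRing.Theory Num.Theory.
Local Open Scope quotient_scope.
Local Open Scope classical_set_scope.
Local Open Scope group_scope.

(** * Quotients of (possibly infinite) groups *)

Record normal_subgroup (G : groupType) (N : set G) : Prop := NormalSubgroup {
  normal_one : N 1;
  normal_mul : forall x y, N x -> N y -> N (x * y);
  normal_inv : forall x, N x -> N x^-1;
  normal_conj : forall x y, N x -> N (x ^ y) }.

Section QuotientGroup.
Variables (G : groupType) (N : set G) (nN : normal_subgroup N).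

Definition same_coset : rel G := fun x y => `[< N (x^-1 * y) >].

Lemma same_coset_refl : reflexive same_coset.
Proof. by move=> x; apply/asboolP; rewrite mulVg; apply: normal_one. Qed.

Lemma same_coset_sym : symmetric same_coset.
Proof.
have H x y : same_coset x y -> same_coset y x.
  move=> /asboolP/(normal_inv nN); rewrite invgM invgK => Nyx.
  exact/asboolP.
by move=> x y; apply/idP/idP; apply: H.
Qed.

Lemma same_coset_trans : transitive same_coset.
Proof.
move=> y x z /asboolP Nxy /asboolP Nyz; apply/asboolP.
by have := normal_mul nN Nxy Nyz; rewrite mulgA mulgK.
Qed.

Canonical same_coset_equiv :=
  EquivRel same_coset same_coset_refl same_coset_sym same_coset_trans.

Definition quotient_group := {eq_quot same_coset}.
HB.instance Definition _ := Choice.on quotient_group.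
HB.instance Definition _ := EqQuotient.on quotient_group.

Lemma quotient_eqP (x y : G) :
  reflect (\pi_(quotient_group) x = \pi_(quotient_group) y) (same_coset x y).
Proof. exact: eqmodP. Qed.

Definition quotient_mul (a b : quotient_group) : quotient_group :=
  \pi_(quotient_group) (repr a * repr b).
Definition quotient_inv (a : quotient_group) : quotient_group :=
  \pi_(quotient_group) (repr a)^-1.

Lemma same_coset_repr x : N (x^-1 * repr (\pi_(quotient_group) x)).
Proof. by apply/asboolP/quotient_eqP; rewrite reprK. Qed.

Lemma pi_quotient_mul x y :
  quotient_mul (\pi x) (\pi y) = \pi_(quotient_group) (x * y).
Proof.
apply/esym/quotient_eqP/asboolP.
set x' := repr _; set y' := repr _.
have Nx : N (x^-1 * x') := same_coset_repr x.
have Ny : N (y^-1 * y') := same_coset_repr y.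
suff -> : (x * y)^-1 * (x' * y') = (x^-1 * x') ^ y * (y^-1 * y').
  by apply: (normal_mul nN) => //; apply: normal_conj.
by rewrite invgM conjgE !mulgA mulgK.
Qed.

Lemma pi_quotient_inv x : quotient_inv (\pi x) = \pi_(quotient_group) x^-1.
Proof.
apply/esym/quotient_eqP/asboolP; rewrite invgK.
set x' := repr _.
have Nx : N (x^-1 * x') := same_coset_repr x.
suff -> : x * x'^-1 = ((x^-1 * x')^-1) ^ x^-1.
  by apply/(normal_conj nN)/(normal_inv nN).
by rewrite conjgE invgM !invgK !mulgA mulgK.
Qed.

Lemma quotient_mulA : associative quotient_mul.
Proof.
move=> a b c; rewrite -[a]reprK -[b]reprK -[c]reprK.
by rewrite !pi_quotient_mul mulgA.
Qed.
Lemma quotient_mul1g : left_id (\pi_(quotient_group) 1) quotient_mul.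
Proof. by move=> a; rewrite -[a]reprK pi_quotient_mul mul1g. Qed.
Lemma quotient_mulg1 : right_id (\pi_(quotient_group) 1) quotient_mul.
Proof. by move=> a; rewrite -[a]reprK pi_quotient_mul mulg1. Qed.
Lemma quotient_mulVg :
  left_inverse (\pi_(quotient_group) 1) quotient_inv quotient_mul.
Proof.
by move=> a; rewrite -[a]reprK pi_quotient_inv pi_quotient_mul mulVg.
Qed.
Lemma quotient_mulgV :
  right_inverse (\pi_(quotient_group) 1) quotient_inv quotient_mul.
Proof.
by move=> a; rewrite -[a]reprK pi_quotient_inv pi_quotient_mul mulgV.
Qed.

HB.instance Definition _ := isGroup.Build quotient_group
  quotient_mulA quotient_mul1g quotient_mulg1 quotient_mulVg quotient_mulgV.

Definition quotient_proj (x : G) : quotient_group := \pi_(quotient_group) x.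

Lemma quotient_proj_morphism : monoid.monoid_morphism quotient_proj.
Proof. by split=> // x y; rewrite /quotient_proj -pi_quotient_mul. Qed.

End QuotientGroup.

Definition center_group (G : groupType) : set G :=
  [set x | forall y : G, x * y = y * x].

Lemma center_group_normal (G : groupType) : normal_subgroup (@center_group G).
Proof.
split=> [y|x y Zx Zy z|x Zx y|x y Zx].
- by rewrite mul1g mulg1.
- by rewrite -mulgA (Zy z) mulgA (Zx z) mulgA.
- by apply: (can_inj (mulKg x)); rewrite mulVKg mulgA Zx mulgK.
- by rewrite conjgE Zx mulKg; apply: Zx.
Qed.

Definition normal_closure (G : groupType) (S : set G) : set G :=
  [set x | forall N : set G, normal_subgroup N -> S `<=` N -> N x].

Lemma normal_closure_normal (G : groupType) (S : set G) :
  normal_subgroup (normal_closure S).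
Proof.
split=> [N nN _|x y Sx Sy N nN sN|x Sx N nN sN|x y Sx N nN sN].
- exact: normal_one.
- by apply: (normal_mul nN); [apply: Sx|apply: Sy].
- by apply: (normal_inv nN); apply: Sx.
- by apply: (normal_conj nN); apply: Sx.
Qed.

(** The normal closure of the commutators is the commutator subgroup, as the
    set of commutators is stable under conjugation and inversion. *)
Definition abelianization (G : groupType) : groupType :=
  quotient_group (normal_closure_normal
    [set g : G | exists x y : G, g = [~ x, y]]).

(** * Free groups and presentations *)

Section FreeGroup.
Variable I : choiceType.

(** The letter [(i, true)] is the generator [i], [(i, false)] its inverse. *)
Local Notation word := (seq (I * bool)).

Inductive freely_equal : word -> word -> Prop :=
| freely_refl u : freely_equal u u
| freely_sym u v : freely_equal u v -> freely_equal v u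
| freely_trans u v w :
    freely_equal u v -> freely_equal v w -> freely_equal u w
| freely_cancel u v i b :
    freely_equal (u ++ (i, b) :: (i, ~~ b) :: v) (u ++ v).

Definition freely_eqb : rel word := fun u v => `[< freely_equal u v >].

Lemma freely_eqb_refl : reflexive freely_eqb.
Proof. by move=> u; apply/asboolP/freely_refl. Qed.
Lemma freely_eqb_sym : symmetric freely_eqb.
Proof. by move=> u v; apply/asboolP/asboolP; apply: freely_sym. Qed.
Lemma freely_eqb_trans : transitive freely_eqb.
Proof.
by move=> v u w /asboolP uv /asboolP vw; apply/asboolP/(freely_trans uv).
Qed.

Canonical freely_equiv :=
  EquivRel freely_eqb freely_eqb_refl freely_eqb_sym freely_eqb_trans.

Definition free_group := {eq_quot freely_eqb}.
HB.instance Definition _ := Choice.on free_group.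
HB.instance Definition _ := EqQuotient.on free_group.

Lemma free_group_eqP (u v : word) :
  reflect (\pi_(free_group) u = \pi_(free_group) v) (freely_eqb u v).
Proof. exact: eqmodP. Qed.

Lemma freely_catl w u v : freely_equal u v -> freely_equal (w ++ u) (w ++ v).
Proof.
elim=> {u v} [u|u v _ ?|u v x _ uv _|u v i b]; first exact: freely_refl.
- exact: freely_sym.
- exact: freely_trans.
- by rewrite !catA; apply: freely_cancel.
Qed.

Lemma freely_catr w u v : freely_equal u v -> freely_equal (u ++ w) (v ++ w).
Proof.
elim=> {u v} [u|u v _ ?|u v x _ uv _|u v i b]; first exact: freely_refl.
- exact: freely_sym.
- exact: freely_trans.
- by rewrite -!catA; apply: freely_cancel.
Qed.

Definition word_inv (u : word) : word :=
  rev [seq (l.1, ~~ l.2) | l <- u].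

Lemma word_inv_cons l u : word_inv (l :: u) = word_inv u ++ [:: (l.1, ~~ l.2)].
Proof. by rewrite /word_inv /= rev_cons cats1. Qed.

Lemma word_inv_cat u v : word_inv (u ++ v) = word_inv v ++ word_inv u.
Proof. by rewrite /word_inv map_cat rev_cat. Qed.

Lemma word_invK : involutive word_inv.
Proof.
move=> u; rewrite /word_inv map_rev revK -map_comp map_id_in // => -[i b] _ /=.
by rewrite negbK.
Qed.

Lemma freely_inv u v : freely_equal u v ->
  freely_equal (word_inv u) (word_inv v).
Proof.
elim=> {u v} [u|u v _ ?|u v x _ uv _|u v i b]; first exact: freely_refl.
- exact: freely_sym.
- exact: freely_trans.
- rewrite !word_inv_cat !word_inv_cons /= negbK -!catA /=.
  exact: freely_cancel.
Qed.

Lemma freely_mulV u : freely_equal (u ++ word_inv u) [::].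
Proof.
elim: u => [|[i b] u IH]; first exact: freely_refl.
rewrite word_inv_cons /= catA.
apply: (freely_trans (freely_catl [:: (i, b)] (freely_catr _ IH))).
exact: (freely_cancel [::] [::]).
Qed.

Definition free_mul (a b : free_group) : free_group :=
  \pi_(free_group) (repr a ++ repr b).
Definition free_inv (a : free_group) : free_group :=
  \pi_(free_group) (word_inv (repr a)).

Lemma freely_repr u : freely_equal u (repr (\pi_(free_group) u)).
Proof. by apply/asboolP/free_group_eqP; rewrite reprK. Qed.

Lemma pi_free_mul u v : free_mul (\pi u) (\pi v) = \pi_(free_group) (u ++ v).
Proof.
apply/esym/free_group_eqP/asboolP.
apply: (freely_trans (freely_catl _ (freely_repr v))).
exact/freely_catr/freely_repr.
Qed.

Lemma pi_free_inv u : free_inv (\pi u) = \pi_(free_group) (word_inv u).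
Proof. exact/esym/free_group_eqP/asboolP/freely_inv/freely_repr. Qed.

Lemma free_mulA : associative free_mul.
Proof.
move=> a b c; rewrite -[a]reprK -[b]reprK -[c]reprK.
by rewrite !pi_free_mul catA.
Qed.
Lemma free_mul1g : left_id (\pi_(free_group) [::]) free_mul.
Proof. by move=> a; rewrite -[a]reprK pi_free_mul. Qed.
Lemma free_mulg1 : right_id (\pi_(free_group) [::]) free_mul.
Proof. by move=> a; rewrite -[a]reprK pi_free_mul cats0. Qed.
Lemma free_mulgV : right_inverse (\pi_(free_group) [::]) free_inv free_mul.
Proof.
move=> a; rewrite -[a]reprK pi_free_inv pi_free_mul.
exact/free_group_eqP/asboolP/freely_mulV.
Qed.
Lemma free_mulVg : left_inverse (\pi_(free_group) [::]) free_inv free_mul.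
Proof.
move=> a; rewrite -[a]reprK pi_free_inv pi_free_mul.
apply/free_group_eqP/asboolP.
by rewrite -[X in _ ++ X]word_invK; apply: freely_mulV.
Qed.

HB.instance Definition _ := isGroup.Build free_group
  free_mulA free_mul1g free_mulg1 free_mulVg free_mulgV.

Definition free_gen (i : I) : free_group := \pi_(free_group) [:: (i, true)].

End FreeGroup.

Definition presented_group (I : choiceType) (rels : set (free_group I)) :
  groupType := quotient_group (normal_closure_normal rels).

(** * The fundamental groups *)

Definition expgz (G : groupType) (x : G) (z : int) : G :=
  match z with Posz k => x ^+ k | Negz k => x ^- k.+1 end.

(** The generator [t_k] is [Some k], the generator [h] is [None]. *)
Definition seifert_relators (n : nat) (m : 'I_n -> nat) (c0 : int)
    (c : 'I_n -> int) : set (free_group (option 'I_n)) :=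
  let t (k : 'I_n) := free_gen (Some k) in
  let h := free_gen (None : option 'I_n) in
  [set r | (exists k, r = t k ^+ m k * expgz h (c k))
        \/ r = (\prod_(k < n) t k) * expgz h c0
        \/ (exists k, r = [~ h, t k])].

Definition seifert_pi1 n (m : 'I_n -> nat) c0 (c : 'I_n -> int) : groupType :=
  presented_group (seifert_relators m c0 c).

Definition dolgachev_relators (n : nat) (m : 'I_n -> nat) :
    set (free_group 'I_n) :=
  let t (k : 'I_n) := free_gen k in
  [set r | (exists k, r = t k ^+ m k) \/ r = \prod_(k < n) t k].

Definition dolgachev_pi1 n (m : 'I_n -> nat) : groupType :=
  presented_group (dolgachev_relators m).

(** [H_1(Y; Z)] is the abelianization of [pi_1(Y)]; a closed oriented
    3-manifold is an integral homology sphere as soon as it vanishes. The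
    coprimality of [m_k] and [c_k] is part of the notion of Seifert
    invariants. *)
Definition seifert_homology_sphere n (m : 'I_n -> nat) (c0 : int)
    (c : 'I_n -> int) : Prop :=
  (forall k, coprimez (m k) (c k)) /\
  (forall x : abelianization (seifert_pi1 m c0 c), x = 1).

(** * The group PU(2,1) and its adjoint representation *)

Section PU21.
Variable R : realType.
Local Notation C := (R[i])%type.
Local Open Scope ring_scope.

Definition form21 (z : 'cV[C]_3) : C :=
  `|z 0 0| ^+ 2 - `|z 1 0| ^+ 2 - `|z 2 0| ^+ 2.

Definition in_U21 (A : 'M[C]_3) : bool :=
  (A \in unitmx) && `[< forall z, form21 (A *m z) = form21 z >].

Record U21 := MkU21 { U21_val :> 'M[C]_3; U21_valP : in_U21 U21_val }.
HB.instance Definition _ := [isSub for U21_val].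
HB.instance Definition _ := [Choice of U21 by <:].

Lemma in_U21_mul A B : in_U21 A -> in_U21 B -> in_U21 (A *m B).
Proof.
move=> /andP[uA /asboolP fA] /andP[uB /asboolP fB]; apply/andP; split.
  by rewrite unitmx_mul uA.
by apply/asboolP => z; rewrite -mulmxA fA fB.
Qed.

Lemma in_U21_inv A : in_U21 A -> in_U21 (invmx A).
Proof.
move=> /andP[uA /asboolP fA]; apply/andP; split; first by rewrite unitmx_inv.
by apply/asboolP => z; rewrite -fA mulKVmx.
Qed.

Lemma in_U21_1 : in_U21 1%:M.
Proof.
by apply/andP; split; [exact: unitmx1|apply/asboolP => z; rewrite mul1mx].
Qed.

Definition U21_mul (A B : U21) := MkU21 (in_U21_mul (U21_valP A) (U21_valP B)).
Definition U21_inv (A : U21) := MkU21 (in_U21_inv (U21_valP A)).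
Definition U21_one := MkU21 in_U21_1.

Lemma U21_unit (A : U21) : U21_val A \in unitmx.
Proof. by case/andP: (U21_valP A). Qed.

Lemma U21_mulA : associative U21_mul.
Proof. by move=> A B D; apply: val_inj; rewrite /= mulmxA. Qed.
Lemma U21_mul1g : left_id U21_one U21_mul.
Proof. by move=> A; apply: val_inj; rewrite /= mul1mx. Qed.
Lemma U21_mulg1 : right_id U21_one U21_mul.
Proof. by move=> A; apply: val_inj; rewrite /= mulmx1. Qed.
Lemma U21_mulVg : left_inverse U21_one U21_inv U21_mul.
Proof. by move=> A; apply: val_inj; rewrite /= mulVmx // U21_unit. Qed.
Lemma U21_mulgV : right_inverse U21_one U21_inv U21_mul.
Proof. by move=> A; apply: val_inj; rewrite /= mulmxV // U21_unit. Qed.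

HB.instance Definition _ := isGroup.Build U21
  U21_mulA U21_mul1g U21_mulg1 U21_mulVg U21_mulgV.

Definition PU21 : groupType := quotient_group (center_group_normal U21).

Definition PU21_class (g : U21) : PU21 :=
  quotient_proj (center_group_normal U21) g.

(** The Lie algebra of [PU(2,1) = U(2,1)/Z], that is [u(2,1)/iR], is identified
    with the real Lie algebra [su(2,1)], a complement of [iR] in [u(2,1)] that
    is stable under conjugation by [U(2,1)]. *)
Definition form21_mx : 'M[C]_3 :=
  \matrix_(i, j) (if i == j then (if i == 0 then 1 else -1) else 0).

Definition su21 : set 'M[C]_3 :=
  [set A | (map_mx (@Num.conj C) A)^T *m form21_mx + form21_mx *m A = 0
           /\ \tr A = 0].

(** Independent of the representative by [Ad21_class]. *)
Definition Ad21 (p : PU21) (A : 'M[C]_3) : 'M[C]_3 :=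
  let g : U21 := repr p in U21_val g *m A *m invmx (U21_val g).

Definition real_subspace (V : set 'M[C]_3) : Prop :=
  [/\ V 0, forall A B, V A -> V B -> V (A + B)
    & forall (r : R) A, V A -> V (r%:C%C *: A)].

Definition irreducible_rep (H : groupType) (rho : H -> PU21) : Prop :=
  forall V : set 'M[C]_3, real_subspace V -> V `<=` su21 ->
    (forall x A, V A -> V (Ad21 (rho x) A)) ->
    V = [set 0] \/ V = su21.

Definition Hom_irr (H : groupType) : set (H -> PU21) :=
  [set rho | monoid.monoid_morphism rho /\ irreducible_rep rho].

End PU21.
Arguments Hom_irr : clear implicits.

Section CenterU21.
Variable R : realType.
Local Notation C := (R[i])%type.
Local Open Scope ring_scope.

Local Definition mx3 (a b c d e f g h k : C) : 'M[C]_3 :=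
  \matrix_(i, j) nth 0 (nth [::] [:: [:: a; b; c]; [:: d; e; f]; [:: g; h; k]] i) j.

Lemma mx3P (A B : 'M[C]_3) :
  [/\ A 0 0 = B 0 0, A 0 1 = B 0 1 & A 0 2 = B 0 2] ->
  [/\ A 1 0 = B 1 0, A 1 1 = B 1 1 & A 1 2 = B 1 2] ->
  [/\ A 2 0 = B 2 0, A 2 1 = B 2 1 & A 2 2 = B 2 2] -> A = B.
Proof.
move=> [? ? ?] [? ? ?] [? ? ?]; apply/matrixP => i j.
have ord3 (k : 'I_3) : [\/ k = 0, k = 1 | k = 2].
  by case: k => -[|[|[|//]]] lt; [constructor 1|constructor 2|constructor 3];
    apply: val_inj.
by case: (ord3 i) => ->; case: (ord3 j) => ->.
Qed.

Lemma mulmx3E n (A : 'M[C]_3) (B : 'M[C]_(3, n)) i j :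
  (A *m B) i j = A i 0 * B 0 j + A i 1 * B 1 j + A i 2 * B 2 j.
Proof.
rewrite mxE !big_ord_recl big_ord0 addr0 addrA.
by congr (_ + A i _ * B _ j + A i _ * B _ j); apply: val_inj.
Qed.

Lemma in_U21_involution (A : 'M[C]_3) : A *m A = 1%:M ->
  (forall z, form21 (A *m z) = form21 z) -> in_U21 A.
Proof.
move=> AA fA; apply/andP; split; last exact/asboolP.
by case: (mulmx1_unit AA).
Qed.

Definition probe0 := mx3 (- 1) 0 0 0 1 0 0 0 1.
Definition probe1 := mx3 1 0 0 0 (- 1) 0 0 0 1.
Definition probe2 := mx3 1 0 0 0 0 1 0 1 0.
Definition probe3 := mx3 (5 / 4) (3 / 4) 0 (- (3 / 4)) (- (5 / 4)) 0 0 0 1.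

Lemma probe_U21 : [/\ in_U21 probe0, in_U21 probe1, in_U21 probe2 & in_U21 probe3].
Proof.
have P A : A *m A = 1%:M ->
    (forall z, form21 (A *m z) = form21 z) -> in_U21 A := @in_U21_involution A.
split; apply: P => [|z].
1,3,5,7: apply: mx3P; split; rewrite !mulmx3E !mxE /=; try by field.
all: rewrite /form21 !mulmx3E !mxE /= !normCK.
all: rewrite ?(rmorph_nat, rmorphD, rmorphM, rmorphN, rmorph1, rmorph0, fmorphV) /=.

all: by field.

Qed.

Lemma center_U21_scalar (g : U21 R) :
  center_group g -> exists a : C, U21_val g = a%:M.
Proof.
move=> Zg; exists (U21_val g 0 0).
have Z A (uA : in_U21 A) i j : (U21_val g *m A) i j = (A *m U21_val g) i j.
  by have /(congr1 val) /= -> := Zg (MkU21 uA).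
have [U0 U1 U2 U3] := probe_U21.
have Z0 i j := Z _ U0 i j; have Z1 i j := Z _ U1 i j.
have Z2 i j := Z _ U2 i j; have Z3 i j := Z _ U3 i j.
move: (Z0 0 1) (Z0 0 2) (Z0 1 0) (Z0 2 0) (Z1 1 2) (Z1 2 1) (Z2 1 2) (Z3 0 1).
rewrite !mulmx3E !mxE /= !(mulr0, mul0r, mulr1, mul1r, addr0, add0r, mulrN, mulNr).
have E (x : C) : x = - x -> x = 0 by move/eqP; rewrite -addr_eq0 -mulr2n mulrn_eq0 => /eqP.
have E' (x : C) : - x = x -> x = 0 by move/esym/E.
move=> /E e01 /E e02 /E' e10 /E' e20 /E e12 /E' e21 e1.
rewrite e01 mulr0 mul0r oppr0 !addr0 add0r mulrC => /mulfI e2.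
have {}e2 : U21_val g 0 0 = U21_val g 1 1.
  by apply: e2; rewrite mulf_neq0 ?invr_eq0 ?pnatr_eq0.
by apply: mx3P; split; rewrite !mxE /= -?e1 -?e2.
Qed.

Lemma Ad21_class (g : U21 R) (A : 'M[C]_3) :
  Ad21 (PU21_class g) A = U21_val g *m A *m invmx (U21_val g).
Proof.
rewrite /Ad21 /PU21_class /quotient_proj; set g' : U21 R := repr _.
have /center_U21_scalar[a ga] : center_group (g^-1 * g')%g := same_coset_repr _ g.
have ug := U21_unit g; have ug' := U21_unit g'.
have g'E : U21_val g' = a *: U21_val g.
  by rewrite -mul_mx_scalar -ga /= mulKVmx.
suff -> : U21_val g' *m A = U21_val g *m A *m invmx (U21_val g) *m U21_val g'.
  by rewrite mulmxK.
by rewrite g'E -scalemxAl -scalemxAr mulmxKV.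
Qed.

End CenterU21.

(* Main.v *)
(** The element [h] is central in [pi_1(Y)], so for an irreducible [rho] the
    image [rho h] centralizes the image of [rho], and the vectors of [su(2,1)]
    fixed by [Ad (rho h)] form a subrepresentation. It is nonzero, as an element
    [g] of [U(2,1)] commutes with the trace-free parts of [g - g^-1] and
    [i (g + g^-1)], which both vanish only if [g] is scalar. So it is all of
    [su(2,1)] and [rho h = 1]: every irreducible representation of [pi_1(Y)]
    factors uniquely through the quotient [pi_1(X)] of [pi_1(Y)] by [h]. *)

Require Import Defs.
From mathcomp Require Import all_boot all_order all_algebra.
From mathcomp Require Import boolp classical_sets functions reals.
From mathcomp Require Import complex ring.

Set Implicit Arguments.
Unset Strict Implicit.
Unset Printing Implicit Defensive.

Import Order.TTheory GRing.Theory Num.Theory.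
Local Open Scope quotient_scope.
Local Open Scope classical_set_scope.
Local Open Scope group_scope.

(** * Group morphisms and their kernels *)

Section Morphisms.
Variables (G H : groupType) (f : G -> H).
Hypothesis fM : monoid.monoid_morphism f.

Lemma morph_inv x : f x^-1 = (f x)^-1.
Proof. by apply: (mulIg (f x)); rewrite -fM.2 !mulVg fM.1. Qed.

Lemma morph_exp x k : f (x ^+ k) = f x ^+ k.
Proof. by elim: k => [|k IH]; rewrite ?expg0 ?fM.1 // !expgS fM.2 IH. Qed.

Lemma morph_expgz x z : f (expgz x z) = expgz (f x) z.
Proof. by case: z => k /=; rewrite ?morph_inv morph_exp. Qed.

Lemma morph_prod n (x : 'I_n -> G) :
  f (\prod_(k < n) x k) = \prod_(k < n) f (x k).
Proof. exact: (big_morph f fM.2 fM.1). Qed.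

Lemma morph_commg x y : f [~ x, y] = [~ f x, f y].
Proof. by rewrite !commgEl !conjgE !fM.2 !morph_inv. Qed.

Lemma kernel_normal : normal_subgroup [set x | f x = 1].
Proof.
split=> [|x y /= fx fy|x /= fx|x y /= fx]; first exact: fM.1.
- by rewrite fM.2 fx fy mulg1.
- by rewrite morph_inv fx invg1.
- by rewrite conjgE !fM.2 morph_inv fx mul1g mulVg.
Qed.

End Morphisms.

Lemma morph_comp (G H K : groupType) (f : G -> H) (g : H -> K) :
  monoid.monoid_morphism f -> monoid.monoid_morphism g ->
  monoid.monoid_morphism (g \o f).
Proof. by move=> [f1 fM] [g1 gM]; split=> [|x y] /=; rewrite ?f1 ?fM. Qed.

(** * Universal property of free groups *)

Section FreeLift.
Variables (I : choiceType) (G : groupType) (f : I -> G).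

Definition word_eval (u : seq (I * bool)) : G :=
  \prod_(l <- u) (if l.2 then f l.1 else (f l.1)^-1).

Lemma word_eval_freely u v : freely_equal u v -> word_eval u = word_eval v.
Proof.
elim=> {u v} [//|u v _ -> //|u v w _ -> _ -> //|u v i b].
rewrite /word_eval !big_cat /= !big_cons /= mulgA.
by case: b => /=; rewrite ?mulgV ?mulVg ?mulgA ?mulgK ?mulgVK.
Qed.

(** The choice of the representing word is harmless, since [word_eval] is constant on freely equal
    words. *)
Definition free_lift (a : free_group I) : G := word_eval (repr a).

Lemma free_lift_pi u : free_lift (\pi u) = word_eval u.
Proof. exact/esym/word_eval_freely/freely_repr. Qed.

Lemma free_lift_morphism : monoid.monoid_morphism free_lift.
Proof.
split=> [|a b]; first by rewrite /= (free_lift_pi [::]) /word_eval big_nil.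
by rewrite -[a]reprK -[b]reprK [X in free_lift X]pi_free_mul !free_lift_pi
           /word_eval big_cat.
Qed.

Lemma free_lift_gen i : free_lift (free_gen i) = f i.
Proof. by rewrite free_lift_pi /word_eval big_seq1. Qed.

End FreeLift.

Lemma free_group_gen_ind (I : choiceType) (P : free_group I -> Prop) :
  P 1 -> (forall x y, P x -> P y -> P (x * y)) -> (forall x, P x -> P x^-1) ->
  (forall i, P (free_gen i)) -> forall x, P x.
Proof.
move=> P1 PM PV Pgen x; rewrite -[x]reprK; elim: (repr x) => [|[i b] u IH] //.
rewrite -cat1s -pi_free_mul; apply: PM => //.
case: b; first exact: Pgen.
by have /PV := Pgen i; rewrite [_^-1]pi_free_inv.
Qed.

(** * Universal property of group presentations *)

Section PresentedGroup.
Variables (I : choiceType) (rels : set (free_group I)).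
Local Notation P := (presented_group rels).
Local Notation proj := (quotient_proj (normal_closure_normal rels)).

Definition pres_gen (i : I) : P := proj (free_gen i).

Lemma pres_projK (x : P) : proj (repr x) = x.
Proof. exact: reprK. Qed.

Lemma pres_rel r : rels r -> proj r = 1.
Proof.
(* Being in the coset of [1] means that [r^-1 * 1] lies in every such [N], hence the later passage
   to the inverse. *)
move=> rr; apply/quotient_eqP/asboolP => N nN sN; rewrite mulg1.
exact/(normal_inv nN)/sN.
Qed.

Lemma pres_gen_ind (Q : P -> Prop) :
  Q 1 -> (forall x y, Q x -> Q y -> Q (x * y)) -> (forall x, Q x -> Q x^-1) ->
  (forall i, Q (pres_gen i)) -> forall x, Q x.
Proof.
have projM : monoid.monoid_morphism proj := quotient_proj_morphism _.
move=> Q1 QM QV Qgen x; rewrite -[x]pres_projK.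
apply: (@free_group_gen_ind I (fun y => Q (proj y))) => [|y z|y|//].
- by rewrite projM.1.
- by rewrite projM.2; apply: QM.
- by rewrite (morph_inv projM); apply: QV.
Qed.

Lemma pres_morph_ext (G : groupType) (f g : P -> G) :
  monoid.monoid_morphism f -> monoid.monoid_morphism g ->
  (forall i, f (pres_gen i) = g (pres_gen i)) -> f = g.
Proof.
move=> fM gM fg; apply/funext; apply: pres_gen_ind => // [|x y fx fy|x fx].
- by rewrite fM.1 gM.1.
- by rewrite fM.2 gM.2 fx fy.
- by rewrite (morph_inv fM) (morph_inv gM) fx.
Qed.

Variables (G : groupType) (f : I -> G).

(** A morphism only when [f] kills the relators, see [pres_lift_morphism]. *)
Definition pres_lift (x : P) : G := free_lift f (repr x).

Hypothesis f_rels : forall r, rels r -> free_lift f r = 1.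

(** The kernel of [free_lift f] is normal and contains the relators, so it contains their normal
    closure, by an element of which [a] and the representative of its class differ. *)
Lemma pres_lift_proj a : pres_lift (proj a) = free_lift f a.
Proof.
have fM := free_lift_morphism f.
have := same_coset_repr (normal_closure_normal rels) a.
move/(_ _ (kernel_normal fM) f_rels) => /=.
rewrite fM.2 (morph_inv fM) => fa; apply: (mulgI (free_lift f a)^-1).
by rewrite mulVg; exact: fa.
Qed.

Lemma pres_lift_morphism : monoid.monoid_morphism pres_lift.
Proof.
have fM := free_lift_morphism f.
have projM : monoid.monoid_morphism proj := quotient_proj_morphism _.
split=> [|x y]; first by rewrite -projM.1 pres_lift_proj fM.1.
by rewrite -[x]pres_projK -[y]pres_projK -projM.2 !pres_lift_proj fM.2.
Qed.

Lemma pres_lift_gen i : pres_lift (pres_gen i) = f i.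
Proof. by rewrite pres_lift_proj free_lift_gen. Qed.

End PresentedGroup.

(** * The group U(2,1) and its Lie algebra *)

Section AdjointAction.
Variable R : realType.
Local Notation C := (R[i])%type.
Local Open Scope ring_scope.

Local Notation "A ^*T" := ((map_mx (@Num.conj C) A)^T)
  (at level 8, format "A ^*T") : ring_scope.
Local Notation J := (form21_mx R).
Local Notation PU := (PU21 R).

Lemma ctrmx_mul m n p (A : 'M[C]_(m, n)) (B : 'M[C]_(n, p)) :
  (A *m B)^*T = B^*T *m A^*T.
Proof. by rewrite map_mxM trmx_mul. Qed.

Lemma ctrmxD m n (A B : 'M[C]_(m, n)) : (A + B)^*T = A^*T + B^*T.
Proof. by rewrite map_mxD linearD. Qed.

Lemma ctrmxZ m n a (A : 'M[C]_(m, n)) : (a *: A)^*T = a^* *: A^*T.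
Proof. by rewrite map_mxZ linearZ. Qed.

(** Polarization: evaluating at [z + a *: w] for [a = 1] and [a = 'i] kills all the values
    [z^*T *m M *m w], and basis vectors then read off the entries of [M]. *)
Lemma quadratic_form0 n (M : 'M[C]_n) :
  (forall z : 'cV[C]_n, z^*T *m M *m z = 0) -> M = 0.
Proof.
move=> M0; have Mzw (z w : 'cV[C]_n) : z^*T *m M *m w = 0.
  have P (a : C) : a *: (z^*T *m M *m w) + a^* *: (w^*T *m M *m z) = 0.
    have := M0 (z + a *: w).
    rewrite ctrmxD ctrmxZ !(mulmxDl, mulmxDr) -!scalemxAl -!scalemxAr !M0.
    by rewrite !scaler0 addr0 add0r addrC.
  have := P 1; rewrite conjC1 !scale1r => /eqP; rewrite addr_eq0 => /eqP P1.
  have := P 'i; rewrite conjCi P1 scaleNr scalerN -opprD -scalerDl => /eqP.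
  rewrite oppr_eq0 scaler_eq0 -mulr2n mulrn_eq0 /= (negPf (neq0Ci _)) => /eqP ->.
  by rewrite oppr0.
apply/matrixP => i j; rewrite mxE.
have := Mzw (delta_mx i 0) (delta_mx j 0) => /matrixP/(_ 0 0).
by rewrite map_delta_mx trmx_delta -rowE -colE !mxE.
Qed.

Lemma form21_mxE (z : 'cV[C]_3) : z^*T *m J *m z = (form21 z)%:M.
Proof.
have sum3 (F : 'I_3 -> C) : \sum_k F k = F 0 + F 1 + F 2.
  rewrite !big_ord_recl big_ord0 addr0 addrA.
  by congr (_ + F _ + F _); apply: val_inj.
apply/matrixP => i j; rewrite !ord1 -mulmxA mxE sum3 !mulmx3E !mxE /=.
rewrite /form21 !normCK; ring.
Qed.

Lemma form21_mxK : J *m J = 1%:M.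
Proof. by apply: mx3P; split; rewrite !mulmx3E !mxE /=; ring. Qed.

(** Both sides define the same quadratic form, as [g] preserves [form21]; polarization makes the
    matrices equal. *)
Lemma U21_adjoint (g : U21 R) : g^*T *m J *m g = J.
Proof.
apply/eqP; rewrite -subr_eq0; apply/eqP/quadratic_form0 => z.
case/andP: (U21_valP g) => _ /asboolP fg.
rewrite mulmxBr mulmxBl form21_mxE -fg -form21_mxE ctrmx_mul !mulmxA.
exact: subrr.
Qed.

(** Together with [U21_ctrmxV], this exchange rule is what puts [g - g^-1] and [i (g + g^-1)] into
    u(2,1). *)
Lemma U21_ctrmx (g : U21 R) : g^*T *m J = J *m invmx g.
Proof. by rewrite -[X in X *m invmx _](U21_adjoint g) mulmxK // U21_unit. Qed.

Lemma U21_ctrmxV (g : U21 R) : (invmx g)^*T *m J = J *m g.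
Proof. by have := U21_ctrmx g^-1%g; rewrite /= invmxK. Qed.

(** On u(2,1) this is the projection to su(2,1) along the imaginary scalars. *)
Definition traceless (X : 'M[C]_3) : 'M[C]_3 := X - (\tr X / 3)%:M.

(** Since [J *m J = 1], the hypothesis reads [X^*T = - J *m X *m J], so the trace of [X] is purely
    imaginary and the subtracted scalar matrix lies in u(2,1) as well. *)
Lemma su21_traceless (X : 'M[C]_3) :
  X^*T *m J + J *m X = 0 -> su21 (traceless X).
Proof.
move=> uX; split; last first.
  rewrite /traceless raddfB /= mxtrace_scalar -[_ *+ 3]mulr_natr divfK ?subrr //.
  by rewrite pnatr_eq0.
have trX : (\tr X)^* = - \tr X.
  apply/eqP; rewrite -addr_eq0 -trace_map_mx -mxtrace_tr -mxtraceD.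
  move/eqP: uX; rewrite addr_eq0 => /eqP/(congr1 (mulmx^~ J)).
  rewrite -mulmxA form21_mxK mulmx1 => ->.
  by rewrite mulNmx mxtraceD raddfN /= mxtrace_mulC mulmxA form21_mxK mul1mx addNr.
rewrite /traceless map_mxB linearB /= map_scalar_mx tr_scalar_mx mulmxBl mulmxBr.
rewrite mul_scalar_mx mul_mx_scalar rmorphM /= trX fmorphV rmorph_nat.
by rewrite mulNr scaleNr opprK addrACA subrr addr0.
Qed.

(** [g] is a linear combination of [g - g^-1] and [i (g + g^-1)], both of which
    lie in the Lie algebra [u(2,1)]. *)
Lemma U21_su21_span (g : U21 R) : exists X Y a b s,
  [/\ su21 X, su21 Y, comm_mx g X, comm_mx g Y
    & U21_val g = a *: X + b *: Y + s%:M].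
Proof.
pose h := invmx (U21_val g).
have ug := U21_unit g.
have [Jg Jh] := (U21_ctrmx g, U21_ctrmxV g).
have gh : comm_mx g h by rewrite /comm_mx mulmxV ?mulVmx.
have gT X : comm_mx g X -> comm_mx g (traceless X).
  by move=> gX; apply: comm_mxB => //; apply: comm_mx_scalar.
pose X := U21_val g - h; pose Y := 'i *: (U21_val g + h).
(* The coefficients come from g = (X - iY)/2; the scalar [s] restores the traces removed from [X]
   and [Y]. *)
exists (traceless X), (traceless Y), 2^-1, (- 'i / 2).
exists (2^-1 * (\tr X / 3) - 'i / 2 * (\tr Y / 3)).
split; [apply: su21_traceless|apply: su21_traceless|apply: gT|apply: gT|].
- rewrite map_mxB linearB /= mulmxBl mulmxBr Jg Jh.
  by rewrite addrC addrA subrK subrr.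
- rewrite ctrmxZ ctrmxD conjCi -scalemxAl -scalemxAr mulmxDl mulmxDr Jg Jh.
  by rewrite scaleNr [J *m h + _]addrC addNr.
- by apply: comm_mxB => //; apply: comm_mx_refl.
- by rewrite /comm_mx -scalemxAl -scalemxAr mulmxDl mulmxDr gh.
have i2 : - 'i / 2 * 'i = 2^-1 :> C.
  by rewrite mulrAC mulNr -expr2 sqrCi opprK mul1r.
have gE : U21_val g = 2^-1 *: X + (- 'i / 2) *: Y.
  rewrite [_ *: Y]scalerA i2 -scalerDr addrACA addNr addr0 -mulr2n.
  by rewrite -scalerMnr scalerMnl -mulr_natr mulVf ?scale1r // pnatr_eq0.
rewrite {1}gE; clearbody X Y; apply/matrixP => i j; rewrite !mxE.
by case: (i == j); rewrite ?mulr1n ?mulr0n; ring.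
Qed.

(** * The adjoint action of PU(2,1) on su(2,1) *)

Lemma PU21_class_repr (p : PU) : PU21_class (repr p) = p.
Proof. exact: reprK. Qed.

Lemma PU21_classM (g h : U21 R) :
  PU21_class (g * h)%g = (PU21_class g * PU21_class h)%g.
Proof. exact: (quotient_proj_morphism _).2. Qed.

Lemma PU21_class_eq1 (g : U21 R) : center_group g -> PU21_class g = 1%g.
Proof.
move=> Zg; apply/quotient_eqP/asboolP; rewrite mulg1.
exact/(normal_inv (center_group_normal _)).
Qed.

Lemma Ad21M (p q : PU) A : Ad21 (p * q)%g A = Ad21 p (Ad21 q A).
Proof.
rewrite -[p]PU21_class_repr -[q]PU21_class_repr -PU21_classM !Ad21_class /=.
by have /(congr1 val) /= -> := invgM (repr p : U21 R) (repr q); rewrite !mulmxA.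
Qed.

Lemma Ad21D (p : PU) A B : Ad21 p (A + B) = Ad21 p A + Ad21 p B.
Proof. by rewrite /Ad21 mulmxDr mulmxDl. Qed.

Lemma Ad21Z (p : PU) a A : Ad21 p (a *: A) = a *: Ad21 p A.
Proof. by rewrite /Ad21 -scalemxAr -scalemxAl. Qed.

Lemma Ad21_fix (g : U21 R) A : Ad21 (PU21_class g) A = A <-> comm_mx g A.
Proof.
rewrite Ad21_class; split=> [gA|->]; last by rewrite mulmxK // U21_unit.
by rewrite /comm_mx -[in RHS]gA mulmxKV // U21_unit.
Qed.

Lemma su21_subspace : real_subspace (@su21 R).
Proof.
split=> [|A B [uA tA] [uB tB]|r A [uA tA]].
- by split; rewrite ?mxtrace0 // map_mx0 trmx0 mul0mx mulmx0 addr0.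
- split; last by rewrite mxtraceD tA tB addr0.
  by rewrite ctrmxD mulmxDl mulmxDr addrACA uA uB addr0.
- split; last by rewrite mxtraceZ tA mulr0.
  have -> : (r%:C%C *: A)^*T = r%:C%C *: A^*T.
    by rewrite ctrmxZ conj_Creal // complex_real.
  by rewrite -scalemxAl -scalemxAr -scalerDr uA scaler0.
Qed.

Lemma su21_Ad21 (p : PU) A : su21 A -> su21 (Ad21 p A).
Proof.
rewrite /Ad21; move: (repr p : U21 R) => g [uA tA]; have ug := U21_unit g.
split; last by rewrite mxtrace_mulC mulKmx.
rewrite !ctrmx_mul -!mulmxA U21_ctrmx [X in _ *m X]mulmxA.
move/eqP: uA; rewrite addr_eq0 => /eqP ->.
by rewrite mulNmx mulmxN -!mulmxA [X in - X]mulmxA U21_ctrmxV -!mulmxA addNr.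
Qed.

(** When [Ad g] fixes all of [su(2,1)], the span lemma applied to an arbitrary
    [h] in [U(2,1)] shows that [g] commutes with [h]. *)
Lemma irreducible_centralizer (H : groupType) (rho : H -> PU) (p : PU) :
  irreducible_rep rho -> (forall x, p * rho x = rho x * p)%g -> p = 1%g.
Proof.
move=> irr; rewrite -[p]PU21_class_repr; move: (repr p : U21 R) => g pC.
have [su0 suD suZ] := su21_subspace.
apply: PU21_class_eq1 => h; apply: val_inj => /=.
have [||x A [suA gA]|V0|VT] := irr (fun A => su21 A /\ Ad21 (PU21_class g) A = A).
- split=> [|A B [? gA] [? gB]|r A [? gA]]; split; rewrite ?Ad21D ?Ad21Z ?gA ?gB //.
  + by rewrite /Ad21 mulmx0 mul0mx.
  + exact: suD.
  + exact: suZ.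
- by move=> A [].
- by split; [exact: su21_Ad21|rewrite -Ad21M pC Ad21M gA].
(* If only 0 is fixed, the two su(2,1) components of [g], which commute with [g], vanish; what
   remains of [g] is a scalar matrix. *)
- have [X [Y [a [b [s [suX suY gX gY ->]]]]]] := U21_su21_span g.
  have fix0 Z : su21 Z -> comm_mx g Z -> Z = 0.
    move=> suZ' /Ad21_fix gZ.
    by have : [set 0] Z by rewrite -V0.
  rewrite (fix0 X) // (fix0 Y) // !scaler0 !add0r.
  exact: comm_scalar_mx.
- have fixT Z : su21 Z -> comm_mx g Z.
    by rewrite -VT => -[_ /Ad21_fix].
  have [X [Y [a [b [s [suX suY _ _ ->]]]]]] := U21_su21_span h.
  have gZ c Z : su21 Z -> comm_mx g (c *: Z).
    by move=> /fixT gZ; rewrite /comm_mx -scalemxAl -scalemxAr gZ.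
  by do 2?[apply: comm_mxD]; [exact: gZ|exact: gZ|exact: comm_mx_scalar].
Qed.

End AdjointAction.

(** * The projection of pi_1(Y) to pi_1(X) *)

Section SeifertQuotient.
Variables (n : nat) (m : 'I_n -> nat) (c0 : int) (c : 'I_n -> int).
Local Notation piY := (seifert_pi1 m c0 c).
Local Notation piX := (dolgachev_pi1 m).

Let y_gen (j : option 'I_n) : piY := pres_gen (seifert_relators m c0 c) j.
Let x_gen (k : 'I_n) : piX := pres_gen (dolgachev_relators m) k.

Lemma expgz1g (G : groupType) (z : int) : expgz (1 : G) z = 1.
Proof. by case: z => k; rewrite /= expg1n ?invg1. Qed.

(** The commutators of [h] with the [t_k] are relators, and commuting with [h] passes to products
    and inverses. *)
Lemma seifert_h_central (x : piY) : y_gen None * x = x * y_gen None.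
Proof.
have projM := quotient_proj_morphism
  (normal_closure_normal (seifert_relators m c0 c)).
elim/pres_gen_ind: x => [|x y xC yC|x xC|[k|]] //.
- by rewrite mulg1 mul1g.
- by rewrite mulgA xC -mulgA yC mulgA.
- by apply: (mulgI x); rewrite mulgA -xC -!mulgA mulgV mulg1 mulVKg.
- apply/commgP/eqP; rewrite -(morph_commg projM); apply: pres_rel.
  by right; right; exists k.
Qed.

(** Once [h] goes to 1, the factors [h^(c k)] and [h^c0] drop out of the Seifert relators, which
    leaves the Dolgachev relators. *)
Lemma seifert_morph_rels (G : groupType) (rho : piY -> G) :
  monoid.monoid_morphism rho -> rho (y_gen None) = 1 ->
  forall r, dolgachev_relators m r ->
    free_lift (fun k => rho (y_gen (Some k))) r = 1.
Proof.
move=> rhoM rho_h r.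
set f := fun k => _; have fM := free_lift_morphism f.
have projM := quotient_proj_morphism
  (normal_closure_normal (seifert_relators m c0 c)).
have relY a : seifert_relators m c0 c a -> rho (quotient_proj _ a) = 1.
  by move=> /pres_rel ->; rewrite rhoM.1.
have rho_hz z : rho (expgz (y_gen None) z) = 1.
  by rewrite (morph_expgz rhoM) rho_h expgz1g.
case=> [[k ->]|->].
  rewrite (morph_exp fM) free_lift_gen -(morph_exp rhoM).
  have := relY _ (or_introl (ex_intro _ k erefl)).
  by rewrite projM.2 (morph_exp projM) (morph_expgz projM) rhoM.2 rho_hz mulg1.
rewrite (morph_prod fM); under eq_bigr do rewrite free_lift_gen.
rewrite -(morph_prod rhoM).
have := relY _ (or_intror (or_introl erefl)).
by rewrite projM.2 (morph_prod projM) (morph_expgz projM) rhoM.2 rho_hz mulg1.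
Qed.

Definition seifert_to_dolgachev : piY -> piX :=
  pres_lift (rels := seifert_relators m c0 c)
    (fun j => if j is Some k then x_gen k else 1).
Local Notation q := seifert_to_dolgachev.

Let q_rels r : seifert_relators m c0 c r ->
  free_lift (fun j => if j is Some k then x_gen k else 1) r = 1.
Proof.
set f := fun j => _; have fM := free_lift_morphism f.
have projM := quotient_proj_morphism
  (normal_closure_normal (dolgachev_relators m)).
case=> [[k ->]|[->|[k ->]]].
- rewrite fM.2 (morph_exp fM) (morph_expgz fM) !free_lift_gen /= expgz1g mulg1.
  by rewrite -(morph_exp projM); apply: pres_rel; left; exists k.
- rewrite fM.2 (morph_prod fM) (morph_expgz fM) free_lift_gen /= expgz1g mulg1.
  under eq_bigr do rewrite free_lift_gen.
  by rewrite -(morph_prod projM); apply: pres_rel; right.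
- by rewrite (morph_commg fM) !free_lift_gen /=; apply/eqP/commgP/commute_sym/commute1.
Qed.

Lemma seifert_to_dolgachev_morphism : monoid.monoid_morphism q.
Proof. exact: pres_lift_morphism q_rels. Qed.

Lemma seifert_to_dolgachev_t k : q (y_gen (Some k)) = x_gen k.
Proof. exact: (pres_lift_gen q_rels). Qed.

Lemma seifert_to_dolgachev_h : q (y_gen None) = 1.
Proof. exact: (pres_lift_gen q_rels). Qed.

Lemma seifert_to_dolgachev_surj x : exists y, q y = x.
Proof.
have qM := seifert_to_dolgachev_morphism.
elim/pres_gen_ind: x => [|_ _ [x <-] [y <-]|_ [x <-]|k].
- by exists 1; rewrite qM.1.
- by exists (x * y); rewrite qM.2.
- by exists x^-1; rewrite (morph_inv qM).
- by exists (y_gen (Some k)); apply: seifert_to_dolgachev_t.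
Qed.

(** * Descent of irreducible representations *)

Variable R : realType.

(** Defined for every map [rho]; its values are meaningful on irreducible representations, by
    [dolgachev_descentP]. *)
Definition dolgachev_descent (rho : piY -> PU21 R) : piX -> PU21 R :=
  pres_lift (rels := dolgachev_relators m) (fun k => rho (y_gen (Some k))).

(** Centrality of [h] and [irreducible_centralizer] give [rho h = 1], so the relators of pi_1(X) are
    respected; the factorization through [q] is then checked on generators. *)
Lemma dolgachev_descentP rho : Hom_irr R piY rho ->
  monoid.monoid_morphism (dolgachev_descent rho) /\
  dolgachev_descent rho \o q = rho.
Proof.
move=> [rhoM irr]; have rho_h : rho (y_gen None) = 1.
  by apply: (irreducible_centralizer irr) => x; rewrite -!rhoM.2 seifert_h_central.
have rels0 := seifert_morph_rels rhoM rho_h.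
have dM := pres_lift_morphism rels0; split => //.
apply: pres_morph_ext => // [|[k|]].
- exact: morph_comp seifert_to_dolgachev_morphism dM.
- by rewrite /= seifert_to_dolgachev_t; apply: (pres_lift_gen rels0).
- by rewrite /= seifert_to_dolgachev_h rho_h; apply: dM.1.
Qed.

(** As [q] is surjective, [rho] and [rho \o q] have the same image, hence the same invariant
    subspaces. *)
Lemma Hom_irr_comp_seifert (rho : piX -> PU21 R) :
  Hom_irr R piX rho -> Hom_irr R piY (rho \o q).
Proof.
move=> [rhoM irr]; split; first exact: morph_comp seifert_to_dolgachev_morphism rhoM.
move=> V VR Vsu VAd; apply: irr => // x A VA.
by have [y <-] := seifert_to_dolgachev_surj x; apply: VAd.
Qed.

Lemma dolgachev_descent_bij :
  set_bij (Hom_irr R piY) (Hom_irr R piX) dolgachev_descent.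
Proof.
split=> [rho rhoI|rho rho' /set_mem rhoI /set_mem rho'I eq_rho|rho rhoI].
- have [dM dq] := dolgachev_descentP rhoI; split=> // V VR Vsu VAd.
  by apply: rhoI.2 => // y A VA; rewrite -dq; apply: VAd.
(* Injectivity: [rho] is recovered from its descent by composing with [q]. *)
- by rewrite -(dolgachev_descentP rhoI).2 eq_rho (dolgachev_descentP rho'I).2.
- exists (rho \o q); first exact: Hom_irr_comp_seifert.
  have [dM _] := dolgachev_descentP (Hom_irr_comp_seifert rhoI).
  apply: pres_morph_ext => // [|k]; first exact: rhoI.1.
  (* Writing the generator as the image under [q] of [t_k] lets the factorization identity for
     [rho \o q] be evaluated there. *)
  rewrite -[pres_gen _ k]seifert_to_dolgachev_t.
  have [_] := dolgachev_descentP (Hom_irr_comp_seifert rhoI).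
  by move/(congr1 (fun f => f (y_gen (Some k)))).
Qed.

End SeifertQuotient.

Theorem lemma2p4 (R : realType) (n : nat) (m : 'I_n -> nat) (c0 : int)
    (c : 'I_n -> int)
    (n_ge3 : (3 <= n)%N)
    (m_ge2 : forall k : 'I_n, (2 <= m k)%N)
    (m_coprime : forall j k : 'I_n, j != k -> coprime (m j) (m k))
    (not_235 : n = 3%N -> range m <> [set 2%N; 3%N; 5%N])
    (homology_sphere : seifert_homology_sphere m c0 c) :
  exists phi : (seifert_pi1 m c0 c -> PU21 R) -> (dolgachev_pi1 m -> PU21 R),
    set_bij (Hom_irr R (seifert_pi1 m c0 c))
            (Hom_irr R (dolgachev_pi1 m)) phi.
Proof.
by exists (@dolgachev_descent n m c0 c R); apply: dolgachev_descent_bij.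
Qed.
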